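(* Let $H$ be a real Hilbert space with $\dim H\geq 3$, let $k\geq 3$ be an integer and let $F\subset[0,1]$. The following conditions are equivalent: (1) there exist non-empty, convex and closed subsets $A_1,A_2,\dots,A_k\subset H$ such that $$F=\{\alpha\in[0,1]:P_{A_k}^\alpha P_{A_{k-1}}^\alpha\cdots P_{A_1}^\alpha\text{ has a fixed point}\};$$ (2) $0\in F$ and $F$ is an $F_\sigma$ subset of $[0,1]$.
   Context: For a non-empty, convex, closed subset $A$ of a real Hilbert space $H$, $P_A:H\to A$ denotes the metric (nearest-point) projection onto $A$. For $\alpha\in[0,1]$, the $\alpha$-relaxed projection onto $A$ is the map $P_A^\alpha:H\to H$, $P_A^\alpha(x)=\alpha P_A(x)+(1-\alpha)x$. Compositions are written as products, e.g. $P_{A_2}^\alpha P_{A_1}^\alpha=P_{A_2}^\alpha\circ P_{A_1}^\alpha$. *)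

(* Defs.v *)
From Stdlib Require Import Reals Lra ClassicalEpsilon.
Open Scope R_scope.

Record HilbertSpace := {
  hcar :> Type;
  hzero : hcar;
  hadd : hcar -> hcar -> hcar;
  hopp : hcar -> hcar;
  hscal : R -> hcar -> hcar;
  hinner : hcar -> hcar -> R;
  hadd_assoc : forall x y z, hadd x (hadd y z) = hadd (hadd x y) z;
  hadd_comm : forall x y, hadd x y = hadd y x;
  hadd_0 : forall x, hadd x hzero = x;
  hadd_opp : forall x, hadd x (hopp x) = hzero;
  hscal_assoc : forall a b x, hscal a (hscal b x) = hscal (a * b) x;
  hscal_1 : forall x, hscal 1 x = x;
  hscal_distr_l : forall a x y, hscal a (hadd x y) = hadd (hscal a x) (hscal a y);
  hscal_distr_r : forall a b x, hscal (a + b) x = hadd (hscal a x) (hscal b x);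
  hinner_sym : forall x y, hinner x y = hinner y x;
  hinner_add : forall x y z, hinner (hadd x y) z = hinner x z + hinner y z;
  hinner_scal : forall a x y, hinner (hscal a x) y = a * hinner x y;
  hinner_nonneg : forall x, 0 <= hinner x x;
  hinner_def : forall x, hinner x x = 0 -> x = hzero;
  hcomplete : forall u : nat -> hcar,
    (forall eps, 0 < eps -> exists N, forall m n, (N <= m)%nat -> (N <= n)%nat ->
        sqrt (hinner (hadd (u m) (hopp (u n))) (hadd (u m) (hopp (u n)))) < eps) ->
    exists l, forall eps, 0 < eps -> exists N, forall n, (N <= n)%nat ->
        sqrt (hinner (hadd (u n) (hopp l)) (hadd (u n) (hopp l))) < eps
}.

Arguments hzero {h}.
Arguments hadd {h}.
Arguments hopp {h}.
Arguments hscal {h}.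
Arguments hinner {h}.

Definition hnorm {H : HilbertSpace} (x : H) : R := sqrt (hinner x x).
Definition hsub {H : HilbertSpace} (x y : H) : H := hadd x (hopp y).

Definition dim_ge3 (H : HilbertSpace) : Prop :=
  exists x1 x2 x3 : H, forall a b c : R,
    hadd (hscal a x1) (hadd (hscal b x2) (hscal c x3)) = hzero ->
    a = 0 /\ b = 0 /\ c = 0.

Definition nonempty {H : HilbertSpace} (A : H -> Prop) : Prop := exists x, A x.

Definition convex {H : HilbertSpace} (A : H -> Prop) : Prop :=
  forall x y t, A x -> A y -> 0 <= t <= 1 ->
    A (hadd (hscal t x) (hscal (1 - t) y)).

Definition hclosed {H : HilbertSpace} (A : H -> Prop) : Prop :=
  forall x, ~ A x -> exists eps, 0 < eps /\
    forall y, hnorm (hsub y x) < eps -> ~ A y.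

(** metric projection: the (unique, for nonempty closed convex A) nearest
    point of A to x, chosen by Hilbert's epsilon. *)
Definition proj {H : HilbertSpace} (A : H -> Prop) (x : H) : H :=
  epsilon (inhabits (@hzero H))
    (fun p => A p /\ forall a, A a -> hnorm (hsub x p) <= hnorm (hsub x a)).

Definition rproj {H : HilbertSpace} (alpha : R) (A : H -> Prop) (x : H) : H :=
  hadd (hscal alpha (proj A x)) (hscal (1 - alpha) x).

Fixpoint relax_comp {H : HilbertSpace} (alpha : R) (A : nat -> H -> Prop) (n : nat)
  (x : H) : H :=
  match n with
  | O => x
  | S m => rproj alpha (A m) (relax_comp alpha A m x)
  end.

Definition F_sigma (F : R -> Prop) : Prop :=
  exists C : nat -> R -> Prop,
    (forall n, Rtopology.closed_set (C n)) /\
    (forall a, F a <-> exists n, C n a).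

(* Main.v *)
Require Import Defs.
From Stdlib Require Import Reals Lra Lia ClassicalEpsilon Classical.
Open Scope R_scope.

(* Let T_a be the composition of the a-relaxed projections.  If a_j tends to c,
   bounded fixed points of the T_{a_j} are approximate fixed points of T_c, and their
   asymptotic center is a fixed point of T_c: so the parameters with a fixed point of
   norm at most n form a closed set, and F is F_sigma.

   Conversely, let A_1 and A_2 be the two parallel flats of codimension 2 above
   p = (10, -1) and q = (0, -1) in the plane of e1, e2.  For 0 < a and b = 1 - a,
   T_a has a fixed point if and only if A_3 contains a point whose shadow in that
   plane is the point of the shadow of A_3 nearest to (q + b p) / (1 + b).  A_3 is a
   subset of the cylinder above {(x, y) | y >= x^2} whose shadow is dense there, so
   this nearest point can only be some (x, x^2), where x = x(a) depends continuously and
   injectively on a.  Cutting away more and more of the edge of the cylinder, A_3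
   keeps an edge point over (x, x^2) exactly when a lies in one of the closed sets
   C_n whose union is F. *)

(** * Projections and nonexpansive maps *)

Section Inner.
Context {H : HilbertSpace}.
Implicit Types x y z w : H.

Lemma hinner_add_r x y z : hinner x (hadd y z) = hinner x y + hinner x z.
Proof. now rewrite hinner_sym, hinner_add, (hinner_sym _ y), (hinner_sym _ z). Qed.

Lemma hinner_scal_r a x y : hinner x (hscal a y) = a * hinner x y.
Proof. now rewrite hinner_sym, hinner_scal, (hinner_sym _ y). Qed.

Lemma hinner_0 x : hinner hzero x = 0.
Proof. pose proof (hinner_add H hzero hzero x) as E. rewrite hadd_0 in E. lra. Qed.

Lemma hinner_opp x y : hinner (hopp x) y = - hinner x y.
Proof.
  pose proof (hinner_add H x (hopp x) y) as E.
  rewrite hadd_opp, hinner_0 in E. lra.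
Qed.

Lemma hinner_0_r x : hinner x hzero = 0.
Proof. now rewrite hinner_sym, hinner_0. Qed.

Lemma hinner_opp_r x y : hinner x (hopp y) = - hinner x y.
Proof. now rewrite hinner_sym, hinner_opp, (hinner_sym _ y). Qed.

Lemma hsub_0_eq x y : hsub x y = hzero -> x = y.
Proof.
  unfold hsub; intros E.
  rewrite <- (hadd_0 H x), <- (hadd_opp H y), (hadd_comm H y), hadd_assoc, E.
  now rewrite hadd_comm, hadd_0.
Qed.

(** Pairing with an arbitrary [w] turns a vector identity into a real one; [hvec] rests on this and
    usually leaves a goal for [ring]. *)
Lemma hinner_ext x y : (forall w, hinner x w = hinner y w) -> x = y.
Proof.
  intros E. apply hsub_0_eq, hinner_def. unfold hsub at 1.
  rewrite hinner_add, hinner_opp, E. lra.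
Qed.

End Inner.

Ltac hexpand :=
  unfold hsub;
  rewrite ?hinner_add, ?hinner_add_r, ?hinner_scal, ?hinner_scal_r, ?hinner_opp,
    ?hinner_opp_r, ?hinner_0, ?hinner_0_r;
  repeat (progress rewrite ?hinner_add, ?hinner_add_r, ?hinner_scal, ?hinner_scal_r,
    ?hinner_opp, ?hinner_opp_r, ?hinner_0, ?hinner_0_r).

Ltac hvec := apply hinner_ext; intros ?w; hexpand.

Section Norm.
Context {H : HilbertSpace}.
Implicit Types x y z w p : H.

Lemma hnorm_nonneg x : 0 <= hnorm x.
Proof. apply sqrt_pos. Qed.

Lemma hnorm_sqr x : hnorm x * hnorm x = hinner x x.
Proof. apply sqrt_sqrt, hinner_nonneg. Qed.

Lemma hnorm_le_sqr x c : 0 <= c -> hinner x x <= c * c -> hnorm x <= c.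
Proof.
  intros Hc Hx. rewrite <- hnorm_sqr in Hx. pose proof (hnorm_nonneg x). nra.
Qed.

(** Expanding the squared norm of [|y| x - |x| y] gives [2 |x| |y| (|x| |y| - <x, y>) >= 0]; if a
    norm vanishes, so does its vector. *)
Lemma cauchy_schwarz x y : hinner x y <= hnorm x * hnorm y.
Proof.
  pose proof (hnorm_nonneg x) as Px. pose proof (hnorm_nonneg y) as Py.
  pose proof (hnorm_sqr x) as Sx. pose proof (hnorm_sqr y) as Sy.
  pose proof (hinner_nonneg H (hsub (hscal (hnorm y) x) (hscal (hnorm x) y))) as N.
  revert N. hexpand. rewrite (hinner_sym H y x), <- Sx, <- Sy. intros N.
  destruct (Req_dec (hnorm x) 0) as [Zx|Zx].
  { assert (x = hzero) as -> by (apply hinner_def; rewrite <- Sx, Zx; ring).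
    rewrite hinner_0, Zx in *. nra. }
  destruct (Req_dec (hnorm y) 0) as [Zy|Zy].
  { assert (y = hzero) as -> by (apply hinner_def; rewrite <- Sy, Zy; ring).
    rewrite hinner_0_r, Zy in *. nra. }
  assert (0 < hnorm x * hnorm y) by (apply Rmult_lt_0_compat; lra).
  nra.
Qed.

Lemma hnorm_triangle x y : hnorm (hadd x y) <= hnorm x + hnorm y.
Proof.
  pose proof (hnorm_nonneg x). pose proof (hnorm_nonneg y).
  apply hnorm_le_sqr; [lra|]. hexpand. rewrite (hinner_sym H y x).
  pose proof (cauchy_schwarz x y). pose proof (hnorm_sqr x). pose proof (hnorm_sqr y).
  nra.
Qed.

Lemma hnorm_scal a x : hnorm (hscal a x) = Rabs a * hnorm x.
Proof.
  unfold hnorm. hexpand. rewrite <- Rmult_assoc, sqrt_mult_alt by nra.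
  now rewrite <- sqrt_Rsqr_abs.
Qed.

Lemma hnorm_sub_sym x y : hnorm (hsub x y) = hnorm (hsub y x).
Proof. unfold hnorm. f_equal. hexpand. ring. Qed.

Lemma hnorm_sub_triangle x y z : hnorm (hsub x z) <= hnorm (hsub x y) + hnorm (hsub y z).
Proof.
  replace (hsub x z) with (hadd (hsub x y) (hsub y z)) by (hvec; ring).
  apply hnorm_triangle.
Qed.

Lemma hnorm_0 : hnorm (@hzero H) = 0.
Proof. unfold hnorm. rewrite hinner_0. apply sqrt_0. Qed.

Lemma hnorm_sub_diag x : hnorm (hsub x x) = 0.
Proof. unfold hsub. rewrite hadd_opp. apply hnorm_0. Qed.

Lemma hnorm_sub_eq x y : hnorm (hsub x y) <= 0 -> x = y.
Proof.
  intros E. apply hsub_0_eq, hinner_def. rewrite <- hnorm_sqr.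
  pose proof (hnorm_nonneg (hsub x y)). nra.
Qed.

Lemma le_of_le_plus_eps a b : (forall eps, 0 < eps -> a <= b + eps) -> a <= b.
Proof.
  intros E. destruct (Rle_or_lt a b) as [|L]; [assumption|].
  specialize (E ((a - b) / 2)). lra.
Qed.

(** * Strongly convex minimization and asymptotic centers *)

Definition midpoint x y : H := hadd (hscal (1/2) x) (hscal (1 - 1/2) y).


(** The median formula for the triangle [x], [y], [z]. It supplies the midpoint hypothesis of
    [strongly_convex_minimizer]; the first conjunct allows the square root to be squared back. *)
Lemma apollonius x y z r : hnorm (hsub x y) <= r -> hnorm (hsub x z) <= r ->
  0 <= r * r - hinner (hsub y z) (hsub y z) / 4 /\
  hnorm (hsub x (midpoint y z)) <= sqrt (r * r - hinner (hsub y z) (hsub y z) / 4).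
Proof.
  intros Hy Hz.
  pose proof (hnorm_nonneg (hsub x y)). pose proof (hnorm_nonneg (hsub x z)).
  pose proof (hnorm_sqr (hsub x y)). pose proof (hnorm_sqr (hsub x z)).
  assert (E : hinner (hsub x (midpoint y z)) (hsub x (midpoint y z))
    = (hinner (hsub x y) (hsub x y) + hinner (hsub x z) (hsub x z)) / 2
          - hinner (hsub y z) (hsub y z) / 4).
  { unfold midpoint. hexpand.
    rewrite (hinner_sym H y x), (hinner_sym H z x), (hinner_sym H z y). field. }
  pose proof (hinner_nonneg H (hsub x (midpoint y z))).
  split; [nra|]. unfold hnorm at 1. apply sqrt_le_1_alt. nra.
Qed.

(* [B r y] plays the role of [f y <= r] for a function [f] whose square is
   strongly convex. *)
Lemma strongly_convex_minimizer (B : R -> H -> Prop) :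
  (exists r y, B r y) ->
  (forall r y, B r y -> 0 <= r) ->
  (forall r r' y, r <= r' -> B r y -> B r' y) ->
  (forall r y z, B r y -> B r z ->
     0 <= r * r - hinner (hsub y z) (hsub y z) / 4 /\
     B (sqrt (r * r - hinner (hsub y z) (hsub y z) / 4)) (midpoint y z)) ->
  (forall r z, (forall eps, 0 < eps -> exists y, B (r + eps) y /\ hnorm (hsub y z) < eps) ->
     forall eps, 0 < eps -> B (r + eps) z) ->
  exists rho z, (forall r y, B r y -> rho <= r) /\
    (forall eps, 0 < eps -> B (rho + eps) z) /\
    (forall z', (forall eps, 0 < eps -> B (rho + eps) z') -> z' = z).
Proof.
  intros [r0 [y0 B0]] Bpos Bmono Bmid Blim.
  (* [completeness] yields suprema, so the infimum [rho] of the levels is minus the supremum of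
     their opposites. *)
  destruct (completeness (fun t => exists y, B (- t) y)) as [m [Hub Hlub]].
  { exists 0. intros t [y Hy]. apply Bpos in Hy. lra. }
  { exists (- r0), y0. now rewrite Ropp_involutive. }
  set (rho := - m) in *.
  assert (Hrho : forall r y, B r y -> rho <= r).
  { intros r y Hr. assert (- r <= m); [|unfold rho; lra].
    apply Hub. exists y. now rewrite Ropp_involutive. }
  assert (rho0 : 0 <= rho).
  { assert (m <= 0); [|unfold rho; lra]. apply Hlub. intros t [y Hy].
    apply Bpos in Hy. lra. }
  assert (Happ : forall eps, 0 < eps -> exists y, B (rho + eps) y).
  { intros eps He. apply NNPP. intros N.
    assert (m <= m - eps); [|lra]. apply Hlub. intros t [y Hy].
    destruct (Rle_or_lt t (m - eps)) as [|L]; [assumption|].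
    exfalso. apply N. exists y. apply (Bmono (- t)); [unfold rho; lra|assumption]. }
  (* The level of the midpoint is at least [rho], so [rho^2 <= (rho + eps)^2 - |y - z|^2 / 4]. *)
  assert (Hclose : forall eps y z, 0 < eps -> B (rho + eps) y -> B (rho + eps) z ->
    hinner (hsub y z) (hsub y z) <= 4 * (2 * rho + eps) * eps).
  { intros eps y z He Hy Hz. destruct (Bmid _ _ _ Hy Hz) as [P Q].
    apply Hrho in Q. pose proof (sqrt_sqrt _ P). nra. }
  assert (Hsmall : forall d, 0 < d -> exists eps, 0 < eps /\ eps < d /\
    forall y z, B (rho + eps) y -> B (rho + eps) z -> hnorm (hsub y z) < d).
  (* For [eps <= 1] the factor [4 (2 rho + eps)] is at most [D], and [eps D <= d^2 / 2] then gives
     [|y - z|^2 < d^2]. *)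
  { intros d Hd. set (D := 8 * rho + 4).
    assert (0 < d * d / (2 * D)) by (apply Rdiv_lt_0_compat; unfold D; nra).
    exists (Rmin (d / 2) (Rmin 1 (d * d / (2 * D)))).
    pose proof (Rmin_l (d / 2) (Rmin 1 (d * d / (2 * D)))).
    pose proof (Rmin_r (d / 2) (Rmin 1 (d * d / (2 * D)))).
    pose proof (Rmin_l 1 (d * d / (2 * D))).
    pose proof (Rmin_r 1 (d * d / (2 * D))).
    assert (P : 0 < Rmin (d / 2) (Rmin 1 (d * d / (2 * D))))
      by (repeat apply Rmin_pos; lra).
    set (e := Rmin (d / 2) (Rmin 1 (d * d / (2 * D)))) in *.
    repeat split; [lra..|]. intros y z Hy Hz. pose proof (Hclose e y z P Hy Hz) as C.
    pose proof (hnorm_nonneg (hsub y z)). rewrite <- hnorm_sqr in C.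
    assert (e * D <= d * d / 2).
    { replace (d * d / 2) with (d * d / (2 * D) * D) by (field; unfold D; lra).
      apply Rmult_le_compat_r; [unfold D; lra|lra]. }
    unfold D in *. nra. }
  set (pick := fun n : nat => epsilon (inhabits (@hzero H)) (B (rho + / INR (S n)))).
  assert (invpos : forall n, 0 < / INR (S n)).
  { intros n. apply Rinv_0_lt_compat, lt_0_INR. lia. }
  assert (Hpick : forall n, B (rho + / INR (S n)) (pick n)).
  { intros n. unfold pick. apply epsilon_spec, Happ, invpos. }
  assert (Hpick' : forall eps, 0 < eps -> exists N, forall n, (N <= n)%nat ->
    B (rho + eps) (pick n)).
  { intros eps He. destruct (archimed_cor1 eps He) as [N [HN HN0]]. exists N.
    intros n Hn. apply (Bmono (rho + / INR (S n))); [|apply Hpick].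
    apply Rplus_le_compat_l. apply Rle_trans with (/ INR N); [|lra].
    apply Rinv_le_contravar; [now apply lt_0_INR|apply le_INR; lia]. }
  destruct (hcomplete H pick) as [z Hz].
  { intros d Hd. destruct (Hsmall d Hd) as [eps [He [_ Hs]]].
    destruct (Hpick' eps He) as [N HN]. exists N. intros i j Hi Hj.
    apply (Hs (pick i) (pick j)); auto. }
  exists rho, z. split; [assumption|].
  assert (Bz : forall eps, 0 < eps -> B (rho + eps) z).
  { apply Blim. intros eps He. destruct (Hz eps He) as [N HN].
    destruct (Hpick' eps He) as [N' HN']. exists (pick (N + N')%nat).
    split; [apply HN'; lia|apply HN; lia]. }
  split; [assumption|]. intros z' Bz'. apply hnorm_sub_eq.
  apply le_of_le_plus_eps. intros d Hd. destruct (Hsmall d Hd) as [eps [He [_ Hs]]].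
  specialize (Hs z' z (Bz' eps He) (Bz eps He)). lra.
Qed.

(** Here [z] is the unique minimizer of [limsup |u j - y|]. Since [|u j - S z| <= |u j - S (u j)| +
    |u j - z|], the point [S z] is a minimizer too. One [z] serves all maps [S] at once. *)
Lemma asymptotic_center (u : nat -> H) b : (forall j, hnorm (u j) <= b) ->
  exists z, forall S : H -> H,
    (forall x y, hnorm (hsub (S x) (S y)) <= hnorm (hsub x y)) ->
    (forall eps, 0 < eps -> exists N, forall j, (N <= j)%nat ->
       hnorm (hsub (u j) (S (u j))) <= eps) ->
    S z = z.
Proof.
  intros Hb.
  destruct (strongly_convex_minimizer (fun r y => exists N, forall j, (N <= j)%nat ->
    hnorm (hsub (u j) y) <= r)) as [rho [z [_ [Bz uniq]]]].
  - exists b, hzero, O. intros j _.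
    replace (hsub (u j) hzero) with (u j) by (hvec; ring). apply Hb.
  - intros r y [N HN]. specialize (HN N (le_n _)).
    pose proof (hnorm_nonneg (hsub (u N) y)). lra.
  - intros r r' y L [N HN]. exists N. intros j Hj. specialize (HN j Hj). lra.
  - intros r y z [N HN] [M HM]. split.
    + apply (apollonius (u (N + M)%nat)); [apply HN|apply HM]; lia.
    + exists (N + M)%nat. intros j Hj. apply apollonius; [apply HN|apply HM]; lia.
  - intros r z Hz eps He. destruct (Hz (eps / 2)) as [y [[N HN] Hy]]; [lra|].
    exists N. intros j Hj. specialize (HN j Hj).
    pose proof (hnorm_sub_triangle (u j) y z). lra.
  - exists z. intros S HS Happrox. apply uniq. intros eps He.
    destruct (Bz (eps / 2)) as [N HN]; [lra|].
    destruct (Happrox (eps / 2)) as [M HM]; [lra|].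
    exists (N + M)%nat. intros j Hj.
    specialize (HN j ltac:(lia)). specialize (HM j ltac:(lia)).
    pose proof (hnorm_sub_triangle (u j) (S (u j)) (S z)).
    pose proof (HS (u j) z). lra.
Qed.

(** * Metric projections *)

Lemma proj_nearest (A : H -> Prop) x : nonempty A -> convex A -> hclosed A ->
  A (proj A x) /\ forall a, A a -> hnorm (hsub x (proj A x)) <= hnorm (hsub x a).
Proof.
  intros [a0 A0] Acvx Acl. unfold proj. apply epsilon_spec.
  destruct (strongly_convex_minimizer (fun r y => A y /\ hnorm (hsub x y) <= r))
    as [rho [z [Hrho [Bz _]]]].
  - exists (hnorm (hsub x a0)), a0. split; [assumption|lra].
  - intros r y [_ Hy]. pose proof (hnorm_nonneg (hsub x y)). lra.
  - intros r r' y L [Ay Hy]. split; [assumption|lra].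
  - intros r y z [Ay Hy] [Az Hz]. destruct (apollonius x y z r Hy Hz) as [P Q].
    repeat split; try assumption. apply Acvx; [assumption..|lra].
  - intros r z Hz eps He. split.
    + apply NNPP. intros N. destruct (Acl z N) as [d [Hd Hout]].
      destruct (Hz d Hd) as [y [[Ay _] Hy]]. now apply (Hout y).
    + destruct (Hz (eps / 2)) as [y [[_ Hy] Hyz]]; [lra|].
      pose proof (hnorm_sub_triangle x y z). lra.
  - exists z. split; [apply (Bz 1); lra|]. intros a Aa.
    apply Rle_trans with rho; [|apply (Hrho _ a); split; [assumption|lra]].
    apply le_of_le_plus_eps. intros eps He. apply (Bz eps He).
Qed.

(** The obtuse angle condition gives [|x - p|^2 + |a - p|^2 <= |x - a|^2] on [A]. The point chosen
    by [proj] is no farther from [x] than [p], so taking it as [a] forces it to be [p]. *)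
Lemma proj_unique (A : H -> Prop) x p : A p ->
  (forall a, A a -> hinner (hsub x p) (hsub a p) <= 0) -> proj A x = p.
Proof.
  intros Ap Hp.
  assert (E : forall a, A a -> hinner (hsub x p) (hsub x p) + hinner (hsub a p) (hsub a p)
     <= hinner (hsub x a) (hsub x a)).
  { intros a Aa. specialize (Hp a Aa). revert Hp. hexpand.
    rewrite (hinner_sym H a x), (hinner_sym H p x), (hinner_sym H a p). lra. }
  assert (S : A (proj A x) /\
    forall a, A a -> hnorm (hsub x (proj A x)) <= hnorm (hsub x a)).
  { unfold proj. apply epsilon_spec. exists p. split; [assumption|]. intros a Aa.
    apply hnorm_le_sqr; [apply hnorm_nonneg|]. rewrite hnorm_sqr.
    specialize (E a Aa). pose proof (hinner_nonneg H (hsub a p)). lra. }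
  destruct S as [Aq Hq]. set (q := proj A x) in *.
  apply hsub_0_eq, hinner_def. specialize (Hq p Ap). specialize (E q Aq).
  pose proof (hinner_nonneg H (hsub q p)).
  pose proof (hnorm_nonneg (hsub x q)).
  rewrite <- !(hnorm_sqr (hsub x _)) in E. nra.
Qed.

(** Moving from the projection [p] towards [a] by a fraction [t] cannot decrease the distance to
    [x], whence [2 I <= t D]. *)
Lemma proj_variational (A : H -> Prop) x a : nonempty A -> convex A -> hclosed A ->
  A a -> hinner (hsub x (proj A x)) (hsub a (proj A x)) <= 0.
Proof.
  intros Ane Acvx Acl Aa. destruct (proj_nearest A x Ane Acvx Acl) as [Ap Hp].
  set (p := proj A x) in *.
  set (I := hinner (hsub x p) (hsub a p)). set (D := hinner (hsub a p) (hsub a p)).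
  destruct (Rle_or_lt I 0) as [|L]; [assumption|exfalso].
  assert (D0 : 0 <= D) by apply hinner_nonneg.
  assert (E : forall t, 0 < t <= 1 -> 2 * I <= t * D).
  { intros t Ht. pose proof (Hp _ (Acvx a p t Aa Ap ltac:(lra))) as N.
    pose proof (hnorm_nonneg (hsub x p)).
    assert (N2 : hnorm (hsub x p) * hnorm (hsub x p) <=
      hnorm (hsub x (hadd (hscal t a) (hscal (1 - t) p))) *
      hnorm (hsub x (hadd (hscal t a) (hscal (1 - t) p)))) by nra.
    rewrite !hnorm_sqr in N2.
    replace (hinner (hsub x (hadd (hscal t a) (hscal (1 - t) p)))
      (hsub x (hadd (hscal t a) (hscal (1 - t) p)))) with
      (hinner (hsub x p) (hsub x p) - 2 * t * I + t * t * D) in N2; [nra|].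
    unfold I, D. hexpand.
    rewrite (hinner_sym H a x), (hinner_sym H p x), (hinner_sym H a p). ring. }
  (* This [t] is small enough: [t D <= I], which contradicts [2 I <= t D] for positive [I]. *)
  assert (T : 0 < I / (I + D) <= 1).
  { split; [apply Rdiv_lt_0_compat; lra|].
    apply Rmult_le_reg_r with (I + D); [lra|]. unfold Rdiv.
    rewrite Rmult_assoc, Rinv_l by lra. lra. }
  pose proof (E _ T).
  assert (I / (I + D) * (I + D) = I) by (field; lra). nra.
Qed.

(** Adding the two variational inequalities gives [|p - q|^2 <= <x - y, p - q>]; Cauchy-Schwarz
    finishes. *)
Lemma proj_nonexpansive (A : H -> Prop) x y : nonempty A -> convex A -> hclosed A ->
  hnorm (hsub (proj A x) (proj A y)) <= hnorm (hsub x y).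
Proof.
  intros Ane Acvx Acl.
  pose proof (proj_variational A x (proj A y) Ane Acvx Acl
    (proj1 (proj_nearest A y Ane Acvx Acl))) as V.
  pose proof (proj_variational A y (proj A x) Ane Acvx Acl
    (proj1 (proj_nearest A x Ane Acvx Acl))) as W.
  set (p := proj A x) in *. set (q := proj A y) in *.
  pose proof (cauchy_schwarz (hsub x y) (hsub p q)) as C.
  assert (hinner (hsub p q) (hsub p q) <= hinner (hsub x y) (hsub p q)).
  { revert V W. hexpand. rewrite (hinner_sym H q p). lra. }
  pose proof (hnorm_sqr (hsub p q)). pose proof (hnorm_nonneg (hsub p q)).
  pose proof (hnorm_nonneg (hsub x y)). nra.
Qed.

(** * Relaxed projections and their compositions *)

Lemma rproj_nonexpansive (A : H -> Prop) alpha x y : 0 <= alpha <= 1 ->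
  nonempty A -> convex A -> hclosed A ->
  hnorm (hsub (rproj alpha A x) (rproj alpha A y)) <= hnorm (hsub x y).
Proof.
  intros Ha Ane Acvx Acl. unfold rproj.
  pose proof (proj_nonexpansive A x y Ane Acvx Acl).
  replace (hsub (hadd (hscal alpha (proj A x)) (hscal (1 - alpha) x))
    (hadd (hscal alpha (proj A y)) (hscal (1 - alpha) y)))
    with (hadd (hscal alpha (hsub (proj A x) (proj A y))) (hscal (1 - alpha) (hsub x y)))
    by (hvec; ring).
  eapply Rle_trans; [apply hnorm_triangle|].
  rewrite !hnorm_scal, !Rabs_pos_eq by lra. nra.
Qed.

Lemma relax_comp_nonexpansive (A : nat -> H -> Prop) alpha n x y : 0 <= alpha <= 1 ->
  (forall i, (i < n)%nat -> nonempty (A i) /\ convex (A i) /\ hclosed (A i)) ->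
  hnorm (hsub (relax_comp alpha A n x) (relax_comp alpha A n y)) <= hnorm (hsub x y).
Proof.
  intros Ha. induction n as [|n IH]; intros HA; simpl; [lra|].
  destruct (HA n (Nat.lt_succ_diag_r n)) as [? [? ?]].
  eapply Rle_trans; [now apply rproj_nonexpansive|]. apply IH. intros i Hi. apply HA. lia.
Qed.

Lemma rproj_0 (A : H -> Prop) x : rproj 0 A x = x.
Proof. unfold rproj. hvec. ring. Qed.

Lemma relax_comp_0 (A : nat -> H -> Prop) n x : relax_comp 0 A n x = x.
Proof. induction n as [|n IH]; simpl; [reflexivity|]. now rewrite rproj_0. Qed.

(** Changing the parameter of the last factor moves its value by [|alpha - beta| |P v - v|], and
    [|P v - v| <= |v - a|] for any fixed [a] in the set. The induction therefore carries the bound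
    [M] along with [L]. *)
Lemma relax_comp_lipschitz (A : nat -> H -> Prop) n b :
  (forall i, (i < n)%nat -> nonempty (A i) /\ convex (A i) /\ hclosed (A i)) ->
  exists M L, forall alpha beta x, 0 <= alpha <= 1 -> 0 <= beta <= 1 -> hnorm x <= b ->
    hnorm (relax_comp alpha A n x) <= M /\
    hnorm (hsub (relax_comp alpha A n x) (relax_comp beta A n x))
      <= L * Rabs (alpha - beta).
Proof.
  induction n as [|n IH]; intros HA; simpl.
  - exists b, 0. intros. rewrite hnorm_sub_diag. lra.
  - destruct IH as [M [L HML]]; [intros i Hi; apply HA; lia|].
    destruct (HA n (Nat.lt_succ_diag_r n)) as [[a Aa] [Acvx Acl]].
    assert (Ane : nonempty (A n)) by now exists a.
    exists (M + (M + hnorm a)), (L + (M + hnorm a)).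
    intros alpha beta x Ha Hb Hx.
    assert (D : forall u, hnorm u <= M -> hnorm (hsub (proj (A n) u) u) <= M + hnorm a).
    { intros u Hu. rewrite hnorm_sub_sym.
      eapply Rle_trans; [apply (proj_nearest (A n) u Ane Acvx Acl), Aa|].
      replace (hsub u a) with (hadd u (hscal (-1) a)) by (hvec; ring).
      eapply Rle_trans; [apply hnorm_triangle|].
      rewrite hnorm_scal, Rabs_left by lra. lra. }
    destruct (HML alpha beta x Ha Hb Hx) as [Hu Huv].
    destruct (HML beta beta x Hb Hb Hx) as [Hv _].
    set (u := relax_comp alpha A n x) in *. set (v := relax_comp beta A n x) in *.
    split.
    + replace (rproj alpha (A n) u) with (hadd u (hscal alpha (hsub (proj (A n) u) u)))
        by (unfold rproj; hvec; ring).
      eapply Rle_trans; [apply hnorm_triangle|]. rewrite hnorm_scal, Rabs_pos_eq by lra.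
      specialize (D u Hu). pose proof (hnorm_nonneg (hsub (proj (A n) u) u)). nra.
    + eapply Rle_trans; [apply (hnorm_sub_triangle _ (rproj alpha (A n) v))|].
      pose proof (rproj_nonexpansive (A n) alpha u v Ha Ane Acvx Acl).
      replace (hsub (rproj alpha (A n) v) (rproj beta (A n) v)) with
        (hscal (alpha - beta) (hsub (proj (A n) v) v)) by (unfold rproj; hvec; ring).
      rewrite hnorm_scal. specialize (D v Hv). pose proof (Rabs_pos (alpha - beta)). nra.
Qed.

(** * Closedness of the parameters with bounded fixed points *)

Lemma ball_convex r : convex (fun x : H => hnorm x <= r).
Proof.
  intros x y t Hx Hy Ht. eapply Rle_trans; [apply hnorm_triangle|].
  rewrite !hnorm_scal, !Rabs_pos_eq by lra. nra.
Qed.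

Lemma ball_closed r : hclosed (fun x : H => hnorm x <= r).
Proof.
  intros x Hx. exists (hnorm x - r). split; [lra|]. intros y Hy N.
  pose proof (hnorm_triangle y (hsub x y)) as T.
  replace (hadd y (hsub x y)) with x in T by (hvec; ring).
  rewrite hnorm_sub_sym in Hy. lra.
Qed.

Lemma closed_bounded_fixed_point_parameters (A : nat -> H -> Prop) k b : 0 <= b ->
  (forall i, (i < k)%nat -> nonempty (A i) /\ convex (A i) /\ hclosed (A i)) ->
  Rtopology.closed_set
    (fun a => 0 <= a <= 1 /\ exists x, hnorm x <= b /\ relax_comp a A k x = x).
Proof.
  intros Hb HA a Na. unfold complementary in Na. apply NNPP. intros Nopen. apply Na.
  assert (Hseq : forall j : nat, exists p : R * H, 0 <= fst p <= 1 /\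
    Rabs (fst p - a) < / INR (S j) /\ hnorm (snd p) <= b /\
    relax_comp (fst p) A k (snd p) = snd p).
  { intros j. apply NNPP. intros N. apply Nopen.
    assert (P : 0 < / INR (S j)) by (apply Rinv_0_lt_compat, lt_0_INR; lia).
    exists (mkposreal _ P). intros c Hc. unfold disc in Hc; simpl in Hc.
    intros [Hc1 [x [Hx Hfix]]]. apply N. now exists (c, x). }
  apply choice in Hseq. destruct Hseq as [s Hs].
  assert (Hconv : forall eps, 0 < eps -> exists N, forall j, (N <= j)%nat ->
     Rabs (fst (s j) - a) < eps).
  { intros eps He. destruct (archimed_cor1 eps He) as [N [HN HN0]]. exists N.
    intros j Hj. destruct (Hs j) as [_ [Hsj _]]. eapply Rlt_trans; [apply Hsj|].
    apply Rle_lt_trans with (/ INR N); [|lra].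
    apply Rinv_le_contravar; [now apply lt_0_INR|apply le_INR; lia]. }
  assert (Ha : 0 <= a <= 1).
  { split; apply le_of_le_plus_eps; intros eps He; destruct (Hconv eps He) as [N HN];
      specialize (HN N (le_n _)); destruct (Hs N) as [HsN _];
      apply Rabs_def2 in HN; lra. }
  split; [assumption|].
  destruct (asymptotic_center (fun j => snd (s j)) b) as [z Hz].
  { intros j. apply (Hs j). }
  destruct (relax_comp_lipschitz A k b HA) as [M [L HL]].
  exists z. split.
  (* Projecting onto the ball of radius [b] fixes every term of the sequence, hence also its
     asymptotic center; this bounds the norm of [z]. *)
  - assert (E : proj (fun x : H => hnorm x <= b) z = z).
    { apply (Hz (proj (fun x => hnorm x <= b))).
      - intros x y. apply proj_nonexpansive;
          [exists hzero; now rewrite hnorm_0|apply ball_convex|apply ball_closed].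
      - intros eps He. exists O. intros j _.
        rewrite (proj_unique _ (snd (s j)) (snd (s j))).
        + rewrite hnorm_sub_diag. lra.
        + apply (Hs j).
        + intros c _. hexpand. lra. }
    rewrite <- E. apply (proj_nearest (fun x => hnorm x <= b));
      [exists hzero; now rewrite hnorm_0|apply ball_convex|apply ball_closed].
  - apply Hz.
    + intros x y. now apply relax_comp_nonexpansive.
    + intros eps He.
      assert (L0 : 0 < Rabs L + 1) by (pose proof (Rabs_pos L); lra).
      destruct (Hconv (eps / (Rabs L + 1))) as [N HN].
      { now apply Rdiv_lt_0_compat. }
      exists N. intros j Hj. specialize (HN j Hj).
      destruct (Hs j) as [Hj1 [_ [Hj2 Hj3]]].
      destruct (HL (fst (s j)) a (snd (s j)) Hj1 Ha Hj2) as [_ HLj].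
      rewrite Hj3 in HLj. eapply Rle_trans; [apply HLj|].
      pose proof (Rle_abs L). pose proof (Rabs_pos (fst (s j) - a)).
      assert (eps / (Rabs L + 1) * (Rabs L + 1) = eps) by (field; lra).
      nra.
Qed.

Lemma F_sigma_fixed_point_parameters (A : nat -> H -> Prop) k (F : R -> Prop) :
  (forall i, (i < k)%nat -> nonempty (A i) /\ convex (A i) /\ hclosed (A i)) ->
  (forall a, F a <-> 0 <= a <= 1 /\ exists x : H, relax_comp a A k x = x) ->
  F_sigma F.
Proof.
  intros HA HF.
  exists (fun n a => 0 <= a <= 1 /\
    exists x, hnorm x <= INR n /\ relax_comp a A k x = x). split.
  - intros n. apply closed_bounded_fixed_point_parameters; [apply pos_INR|assumption].
  - intros a. rewrite HF. split.
    + intros [Ha [x Hx]]. destruct (INR_unbounded (hnorm x)) as [n Hn].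
      exists n. split; [assumption|]. exists x. split; [lra|assumption].
    + intros [n [Ha [x [_ Hx]]]]. split; [assumption|]. now exists x.
Qed.

End Norm.

(** * Sets with prescribed parameters *)

Section Construction.
Context {H : HilbertSpace}.
Implicit Types x y z w p q : H.

(** * Orthonormal vectors *)

Lemma normalize y : y <> hzero -> exists c, hinner (hscal c y) (hscal c y) = 1 /\ c <> 0.
Proof.
  intros Hy. assert (P : hnorm y <> 0).
  { intros E. apply Hy, hinner_def. rewrite <- hnorm_sqr, E. ring. }
  exists (/ hnorm y). split; [|now apply Rinv_neq_0_compat].
  hexpand. rewrite <- hnorm_sqr. now field.
Qed.

(** Gram-Schmidt. If a remainder vanished, its expansion in [x1], [x2], [x3] would be a relation
    whose leading coefficient is 1. *)
Lemma orthonormal_triple : dim_ge3 H -> exists e1 e2 e3 : H,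
  (hinner e1 e1 = 1 /\ hinner e2 e2 = 1 /\ hinner e3 e3 = 1) /\
  (hinner e1 e2 = 0 /\ hinner e1 e3 = 0 /\ hinner e2 e3 = 0).
Proof.
  intros [x1 [x2 [x3 Hfree]]].
  destruct (normalize x1) as [c1 [N1 C1]].
  { intros E. destruct (Hfree 1 0 0); [rewrite E; hvec; ring|lra]. }
  set (e1 := hscal c1 x1) in *.
  set (y2 := hsub x2 (hscal (hinner x2 e1) e1)).
  assert (O12 : hinner e1 y2 = 0).
  { unfold y2. hexpand. rewrite N1, (hinner_sym H e1). ring. }
  destruct (normalize y2) as [c2 [N2 C2]].
  { intros E. destruct (Hfree (- (hinner x2 e1 * c1)) 1 0) as [_ [F _]]; [|lra].
    rewrite <- E. unfold y2, e1. hvec. ring. }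
  set (e2 := hscal c2 y2) in *.
  assert (O12' : hinner e1 e2 = 0).
  { unfold e2. rewrite hinner_scal_r, O12. ring. }
  set (y3 := hsub x3 (hadd (hscal (hinner x3 e1) e1) (hscal (hinner x3 e2) e2))).
  destruct (normalize y3) as [c3 [N3 C3]].
  { intros E. destruct (Hfree
      (- (hinner x3 e1 * c1) + hinner x3 e2 * c2 * hinner x2 e1 * c1)
      (- (hinner x3 e2 * c2)) 1) as [_ [_ F]]; [|lra].
    rewrite <- E. unfold y3.
    set (t1 := hinner x3 e1). set (t2 := hinner x3 e2).
    unfold e2, y2. set (t3 := hinner x2 e1). unfold e1. hvec. ring. }
  exists e1, e2, (hscal c3 y3). rewrite !hinner_scal_r.
  repeat split; try assumption.
  - now rewrite <- hinner_scal_r.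
  - unfold y3. hexpand. rewrite N1, O12', (hinner_sym H e1 x3). ring.
  - unfold y3. hexpand. rewrite N2, (hinner_sym H e2 e1), O12', (hinner_sym H e2 x3). ring.
Qed.

(** * Closed convex sets *)

Definition closed_convex (A : H -> Prop) : Prop := convex A /\ hclosed A.

Lemma closed_convex_halfspace (A : H -> Prop) u c :
  (forall h, A h <-> c <= hinner h u) -> closed_convex A.
Proof.
  intros HA. split.
  - intros x y t Hx Hy Ht. rewrite HA in *. hexpand. nra.
  - intros x Hx. rewrite HA in Hx. pose proof (hnorm_nonneg u) as P.
    (* By Cauchy-Schwarz, a move shorter than this raises the product with [u] by less than
       [c - <x, u>]; the added 1 covers [u = 0]. *)
    exists ((c - hinner x u) / (hnorm u + 1)). split; [apply Rdiv_lt_0_compat; lra|].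
    intros y Hy. rewrite HA. intros Hc.
    assert (E : hinner (hsub y x) u = hinner y u - hinner x u) by (hexpand; ring).
    pose proof (cauchy_schwarz (hsub y x) u) as CS.
    assert ((c - hinner x u) / (hnorm u + 1) * (hnorm u + 1) = c - hinner x u)
      by (field; lra).
    pose proof (hnorm_nonneg (hsub y x)). nra.
Qed.

Lemma closed_convex_forall (I : Type) (A : I -> H -> Prop) :
  (forall i, closed_convex (A i)) -> closed_convex (fun h => forall i, A i h).
Proof.
  intros HA. split.
  - intros x y t Hx Hy Ht i. now apply (proj1 (HA i)).
  - intros x Hx. apply not_all_ex_not in Hx. destruct Hx as [i Hi].
    destruct (proj2 (HA i) x Hi) as [eps [He Hout]]. exists eps. split; [assumption|].
    intros y Hy Ay. now apply (Hout y).
Qed.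

Lemma closed_convex_and (A B : H -> Prop) :
  closed_convex A -> closed_convex B -> closed_convex (fun h => A h /\ B h).
Proof.
  intros [Acvx Acl] [Bcvx Bcl]. split.
  - intros x y t [] [] Ht. split; [now apply Acvx|now apply Bcvx].
  - intros x Hx. destruct (classic (A x)) as [Ax|NA].
    + destruct (Bcl x) as [eps [He Hout]]; [tauto|]. exists eps. split; [assumption|].
      intros y Hy [_ By]. now apply (Hout y).
    + destruct (Acl x NA) as [eps [He Hout]]. exists eps. split; [assumption|].
      intros y Hy [Ay _]. now apply (Hout y).
Qed.

Lemma closed_convex_hyperplane u c : closed_convex (fun h => hinner h u = c).
Proof.
  assert (E : closed_convex (fun h => c <= hinner h u /\ - c <= hinner h (hopp u))).
  { apply closed_convex_and; eapply closed_convex_halfspace; intros h; reflexivity. }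
  destruct E as [E1 E2]. split.
  - intros x y t Hx Hy Ht. hexpand. rewrite Hx, Hy. ring.
  - intros x Hx. destruct (E2 x) as [eps [He Hout]].
    { rewrite hinner_opp_r. lra. }
    exists eps. split; [assumption|]. intros y Hy Ay. apply (Hout y Hy).
    rewrite hinner_opp_r. lra.
Qed.

Variables e1 e2 e3 : H.
Hypotheses (n11 : hinner e1 e1 = 1) (n22 : hinner e2 e2 = 1) (n33 : hinner e3 e3 = 1).
Hypotheses (o12 : hinner e1 e2 = 0) (o13 : hinner e1 e3 = 0) (o23 : hinner e2 e3 = 0).

Let o21 : hinner e2 e1 = 0. Proof. now rewrite hinner_sym. Qed.
Let o31 : hinner e3 e1 = 0. Proof. now rewrite hinner_sym. Qed.
Let o32 : hinner e3 e2 = 0. Proof. now rewrite hinner_sym. Qed.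

Ltac hcoord := hexpand; rewrite ?n11, ?n22, ?n33, ?o12, ?o13, ?o23, ?o21, ?o31, ?o32.

(** * The two flats and a third set *)

Definition point a b c : H := hadd (hscal a e1) (hadd (hscal b e2) (hscal c e3)).

Definition flat c : H -> Prop := fun h => hinner h e1 = c /\ hinner h e2 = -1.

Lemma flat_closed_convex c : nonempty (flat c) /\ closed_convex (flat c).
Proof.
  split.
  - exists (point c (-1) 0). unfold point, flat. hcoord. lra.
  - apply closed_convex_and; apply closed_convex_hyperplane.
Qed.

Lemma proj_flat c x : proj (flat c) x =
  hadd x (hadd (hscal (c - hinner x e1) e1) (hscal (-1 - hinner x e2) e2)).
Proof.
  apply proj_unique.
  - split; hcoord; ring.
  - intros a [A1 A2]. hcoord.
    rewrite (hinner_sym H e1 a), (hinner_sym H e2 a), (hinner_sym H e1 x),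
      (hinner_sym H e2 x), A1, A2. lra.
Qed.

(** Both maps are affine and alter only the coordinates along [e1] and [e2], so the displacement
    lies in their span. *)
Lemma rproj_flats alpha x :
  rproj alpha (flat 0) (rproj alpha (flat 10) x) =
  hadd x (hadd
    (hscal (alpha * (10 * (1 - alpha) - (2 - alpha) * hinner x e1)) e1)
    (hscal (- alpha * (2 - alpha) * (1 + hinner x e2)) e2)).
Proof. unfold rproj. rewrite !proj_flat. hvec. hcoord. ring. Qed.

(* Up to the factor [3 - 3 alpha + alpha^2], the inequality says that [a] is the
   nearest point of [A] to the point with first coordinate
   [10 (1 - alpha) / (2 - alpha)], second coordinate [-1], and all other
   coordinates equal to those of [a]. *)
Lemma fixed_point_flats (A : H -> Prop) alpha : 0 < alpha <= 1 ->
  nonempty A -> closed_convex A ->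
  ((exists x, rproj alpha A (rproj alpha (flat 0) (rproj alpha (flat 10) x)) = x) <->
   exists a, A a /\ forall q, A q ->
     (10 * (1 - alpha) - (2 - alpha) * hinner a e1) * (hinner q e1 - hinner a e1)
     - (2 - alpha) * (1 + hinner a e2) * (hinner q e2 - hinner a e2) <= 0).
Proof.
  intros Ha Ane [Acvx Acl].
  assert (K0 : 0 < 3 - 3 * alpha + alpha * alpha) by nra.
  split.
  - intros [x Hx]. rewrite rproj_flats in Hx.
    set (y := hadd x _) in Hx. exists (proj A y).
    split; [now apply proj_nearest|]. intros q Aq.
    pose proof (proj_variational A y q Ane Acvx Acl Aq) as V.
    unfold rproj in Hx. set (p := proj A y) in *. set (w := hsub q p) in *.
    (* The [e1] coordinate of the fixed point equation, divided by [alpha]; the factor is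
       [1 + (1 - alpha) (2 - alpha)]. *)
    assert (E1 : (3 - 3 * alpha + alpha * alpha) * hinner x e1
      = hinner p e1 + 10 * (1 - alpha) * (1 - alpha)).
    { apply (Rmult_eq_reg_l alpha); [|lra].
      pose proof (f_equal (fun h => hinner h e1) Hx) as E; simpl in E.
      revert E. unfold y. hcoord. lra. }
    assert (E2 : (3 - 3 * alpha + alpha * alpha) * (1 + hinner x e2)
      = 1 + hinner p e2).
    { apply (Rmult_eq_reg_l alpha); [|lra].
      pose proof (f_equal (fun h => hinner h e2) Hx) as E; simpl in E.
      revert E. unfold y. hcoord. lra. }
    (* From [x = alpha p + (1 - alpha) y] follows [alpha (y - p) = y - x], the displacement by the
       flats. *)
    assert (Ew : hinner (hsub y p) w =
      (10 * (1 - alpha) - (2 - alpha) * hinner x e1) * hinner e1 w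
      - (2 - alpha) * (1 + hinner x e2) * hinner e2 w).
    { apply (Rmult_eq_reg_l alpha); [|lra].
      pose proof (f_equal (fun h => hinner h w) Hx) as E; simpl in E.
      revert E. unfold y.
      rewrite ?hinner_add, ?hinner_scal. unfold hsub at 1.
      rewrite ?hinner_add, ?hinner_scal, ?hinner_opp. lra. }
    replace (hinner q e1 - hinner p e1) with (hinner e1 w)
      by (unfold w; hexpand; rewrite (hinner_sym H e1 q), (hinner_sym H e1 p); ring).
    replace (hinner q e2 - hinner p e2) with (hinner e2 w)
      by (unfold w; hexpand; rewrite (hinner_sym H e2 q), (hinner_sym H e2 p); ring).
    rewrite Ew in V.
    replace ((10 * (1 - alpha) - (2 - alpha) * hinner p e1) * hinner e1 w
      - (2 - alpha) * (1 + hinner p e2) * hinner e2 w) with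
      ((3 - 3 * alpha + alpha * alpha) *
       ((10 * (1 - alpha) - (2 - alpha) * hinner x e1) * hinner e1 w
      - (2 - alpha) * (1 + hinner x e2) * hinner e2 w)); [nra|].
    replace (hinner p e1) with
      ((3 - 3 * alpha + alpha * alpha) * hinner x e1 - 10 * (1 - alpha) * (1 - alpha))
      by lra.
    rewrite <- E2. ring.
  - intros [a [Aa Hq]].
    set (K := 3 - 3 * alpha + alpha * alpha) in *.
    (* The fixed point must be [alpha a + (1 - alpha) y] with [y = a + d]; the displacement formula
       is then a linear equation for [d], solved by [xi] and [eta]. *)
    set (xi := (10 * (1 - alpha) - (2 - alpha) * hinner a e1) / K).
    set (eta := - (2 - alpha) * (1 + hinner a e2) / K).
    set (d := hadd (hscal xi e1) (hscal eta e2)).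
    exists (hadd a (hscal (1 - alpha) d)).
    assert (E : rproj alpha (flat 0) (rproj alpha (flat 10) (hadd a (hscal (1 - alpha) d)))
      = hadd a d).
    { rewrite rproj_flats. unfold d. hvec. hcoord. unfold xi, eta, K. field.
      fold K. lra. }
    rewrite E. unfold rproj.
    rewrite (proj_unique A (hadd a d) a Aa).
    + hvec. ring.
    + intros q Aq. specialize (Hq q Aq).
      replace (hsub (hadd a d) a) with d by (hvec; ring).
      unfold d. hexpand.
      rewrite (hinner_sym H e1 q), (hinner_sym H e2 q), (hinner_sym H e1 a),
        (hinner_sym H e2 a).
      assert (Kxi : K * xi = 10 * (1 - alpha) - (2 - alpha) * hinner a e1)
        by (unfold xi; field; lra).
      assert (Keta : K * eta = - (2 - alpha) * (1 + hinner a e2))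
        by (unfold eta; field; lra).
      apply (Rmult_le_reg_l K); [lra|]. rewrite Rmult_0_r.
      replace (K * _) with (K * xi * (hinner q e1 - hinner a e1)
        + K * eta * (hinner q e2 - hinner a e2)) by ring.
      rewrite Kxi, Keta. lra.
Qed.

(** * The pared cylinder *)

(* For [r = 0] these are the tangent half-spaces of the parabolic cylinder
   [h2 >= h1^2].  The tilted ones keep the edge point over [s] out at every height
   [h3 < n + 1] when [s] is at distance at least [sqrt r] from [C 0, ..., C n], while the tilt
   disappears as [h3] tends to infinity. *)
Definition pared_cylinder (C : nat -> R -> Prop) : H -> Prop := fun h =>
  forall s n r, 0 <= r <= 1 ->
    (forall m t, (m <= n)%nat -> C m t -> r <= (t - s) * (t - s)) ->
    2 * s * hinner h e1 - s * s + r * (INR n + 1 - hinner h e3) / ((INR n + 1) * (INR n + 1))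
      <= hinner h e2.

Lemma pared_cylinder_closed_convex C : closed_convex (pared_cylinder C).
Proof.
  (* The two premises count as indices of the intersection, next to [s], [n] and [r]. *)
  unfold pared_cylinder. do 5 (apply closed_convex_forall; intros ?).
  apply (closed_convex_halfspace _
    (hadd e2 (hadd (hscal (- 2 * i) e1) (hscal (i1 / ((INR i0 + 1) * (INR i0 + 1))) e3)))
    (- (i * i) + i1 * (INR i0 + 1) / ((INR i0 + 1) * (INR i0 + 1)))).
  intros h. hexpand. unfold Rdiv. split; intros; lra.
Qed.

Lemma pared_cylinder_tangent C h s : pared_cylinder C h ->
  2 * s * hinner h e1 - s * s <= hinner h e2.
Proof.
  intros Hh. specialize (Hh s O 0 ltac:(lra)). unfold Rdiv in Hh.
  rewrite !Rmult_0_l, Rplus_0_r in Hh. apply Hh. intros. apply Rle_0_sqr.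
Qed.

(** At height [z], the largest value of [(N - z) / N^2] is [1 / (4 z)], reached at [N = 2 z]. The
    height is chosen to make it [delta]. *)
Lemma pared_cylinder_dense C (x delta : R) : 0 < delta ->
  pared_cylinder C (point x (x * x + delta) (/ (4 * delta))).
Proof.
  intros Hd s n r Hr _. unfold point. hcoord.
  pose proof (pos_INR n) as Hn. set (N := INR n + 1) in *. assert (1 <= N) by (unfold N; lra).
  set (z := / (4 * delta)).
  assert (z0 : 0 < z) by (apply Rinv_0_lt_compat; lra).
  assert (zd : 4 * z * delta = 1) by (unfold z; field; lra).
  assert (W : (N - z) / (N * N) <= delta).
  { apply (Rmult_le_reg_r (4 * z * (N * N))); [apply Rmult_lt_0_compat; nra|].
    replace ((N - z) / (N * N) * (4 * z * (N * N))) with (4 * z * (N - z)) by (field; nra).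
    replace (delta * (4 * z * (N * N))) with (4 * z * delta * (N * N)) by ring.
    rewrite zd. pose proof (Rle_0_sqr (N - 2 * z)). unfold Rsqr in *. lra. }
  pose proof (Rle_0_sqr (x - s)). unfold Rsqr in *.
  match goal with |- context [r * ?a / ?b] =>
    replace (r * a / b) with (r * ((N - z) / (N * N))) end.
  2:{ field. lra. }
  assert (r * ((N - z) / (N * N)) <= delta) by nra.
  lra.
Qed.

(** If [m <= n], the premise bounds [r] by [(x - s)^2] and the tilt factor is at most 1. If [n < m],
    then [n + 1 <= m] and the tilt is not positive. *)
Lemma pared_cylinder_edge (C : nat -> R -> Prop) m (x : R) : C m x ->
  pared_cylinder C (point x (x * x) (INR m)).
Proof.
  intros Cx s n r Hr HC. unfold point. hcoord.
  pose proof (pos_INR n) as Hn. pose proof (pos_INR m) as Hm.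
  set (N := INR n + 1) in *. assert (N1 : 1 <= N) by (unfold N; lra).
  match goal with |- context [r * ?a / ?b] =>
    replace (r * a / b) with (r * ((N - INR m) / (N * N))) by (field; lra) end.
  assert (r * ((N - INR m) / (N * N)) <= (x - s) * (x - s)); [|lra].
  assert (P : 0 < / (N * N)) by (apply Rinv_0_lt_compat; nra).
  assert (PN : / (N * N) * (N * N) = 1) by (field; lra).
  unfold Rdiv. destruct (Nat.le_gt_cases m n) as [Hmn|Hmn].
  - specialize (HC m x Hmn Cx).
    assert (N - INR m <= N * N) by nra.
    assert (W : (N - INR m) * / (N * N) <= / (N * N) * (N * N)).
    { rewrite (Rmult_comm (/ _)). apply Rmult_le_compat_r; lra. }
    rewrite PN in W. nra.
  - assert (N <= INR m).
    { unfold N. rewrite <- S_INR. now apply le_INR. }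
    assert (W : 0 <= (INR m - N) * / (N * N)) by (apply Rmult_le_pos; lra).
    assert (0 <= r * ((INR m - N) * / (N * N))) by (apply Rmult_le_pos; lra).
    pose proof (Rle_0_sqr (x - s)). unfold Rsqr in *. lra.
Qed.

(** Otherwise some [r > 0] separates [x] from the first [n + 1] sets, for each [n]. With [s = x] and
    [n] above the height of [h], the tilt is positive and pushes [h] off the edge. *)
Lemma pared_cylinder_edge_inv (C : nat -> R -> Prop) h (x : R) :
  (forall m, ~ C m x -> exists r, 0 < r /\ forall t, C m t -> r <= (t - x) * (t - x)) ->
  pared_cylinder C h -> hinner h e1 = x -> hinner h e2 = x * x ->
  exists m, C m x.
Proof.
  intros Csep Hh H1 H2. apply NNPP. intros N.
  assert (HC : forall n, exists r, 0 < r <= 1 /\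
    forall m t, (m <= n)%nat -> C m t -> r <= (t - x) * (t - x)).
  { assert (Cx : forall m, ~ C m x) by (intros m Cm; apply N; now exists m).
    induction n as [|n [r [Hr IH]]].
    - destruct (Csep O (Cx O)) as [r [Hr HC]]. exists (Rmin r 1).
      pose proof (Rmin_l r 1). pose proof (Rmin_r r 1).
      pose proof (Rmin_pos r 1 Hr Rlt_0_1).
      split; [lra|]. intros m t Hm Ct. replace m with O in Ct by lia.
      specialize (HC t Ct). lra.
    - destruct (Csep (S n) (Cx (S n))) as [r' [Hr' HC]]. exists (Rmin r r').
      pose proof (Rmin_l r r'). pose proof (Rmin_r r r').
      pose proof (Rmin_pos r r' ltac:(lra) Hr').
      split; [lra|]. intros m t Hm Ct. destruct (Nat.eq_dec m (S n)) as [->|Hne].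
      + specialize (HC t Ct). lra.
      + specialize (IH m t ltac:(lia) Ct). lra. }
  destruct (INR_unbounded (hinner h e3)) as [n Hn].
  destruct (HC n) as [r [Hr Hr']].
  specialize (Hh x n r ltac:(lra) Hr'). rewrite H1, H2 in Hh.
  pose proof (pos_INR n).
  assert (0 < r * (INR n + 1 - hinner h e3) / ((INR n + 1) * (INR n + 1)))
    by (apply Rdiv_lt_0_compat; nra).
  lra.
Qed.

(* [(2 x^3 + 3 x, -1)] lies on the outer normal of the parabola at [(x, x^2)]. *)
Lemma fixed_point_pared_cylinder (C : nat -> R -> Prop) alpha (x : R) : 0 < alpha <= 1 ->
  (2 - alpha) * (2 * (x * x * x) + 3 * x) = 10 * (1 - alpha) ->
  (forall m, ~ C m x -> exists r, 0 < r /\ forall t, C m t -> r <= (t - x) * (t - x)) ->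
  ((exists h, rproj alpha (pared_cylinder C)
                (rproj alpha (flat 0) (rproj alpha (flat 10) h)) = h) <->
   exists m, C m x).
Proof.
  intros Ha Hx Csep. rewrite fixed_point_flats; [|assumption| |].
  2:{ eexists. apply (pared_cylinder_dense C 0 1). lra. }
  2:{ apply pared_cylinder_closed_convex. }
  split.
  - intros [a [Aa Hq]].
    pose proof (pared_cylinder_tangent C a x Aa) as T.
    pose proof (pared_cylinder_tangent C a 0 Aa) as T0.
    set (a1 := hinner a e1) in *. set (a2 := hinner a e2) in *.
    (* The edge point over [x] may be missing from the set, so the inequality is tested on nearby
       points above it, with [delta] tending to 0. *)
    assert (V : (2 * (x * x * x) + 3 * x - a1) * (x - a1) - (1 + a2) * (x * x - a2) <= 0).
    { apply le_of_le_plus_eps. intros eps He.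
      assert (P : 0 < eps / (1 + a2)) by (apply Rdiv_lt_0_compat; lra).
      specialize (Hq _ (pared_cylinder_dense C x _ P)). revert Hq. unfold point. hcoord.
      set (delta := eps / (1 + a2)) in *. rewrite <- Hx.
      assert (Ed : (1 + a2) * delta = eps) by (unfold delta; field; lra).
      rewrite <- Ed. intros Hq. apply (Rmult_le_reg_l (2 - alpha)); [lra|]. lra. }
    (* The vector from [(x, x^2)] to [(2 x^3 + 3 x, -1)] is [x^2 + 1] times [(2 x, -1)], so the
       tangent inequality at [x] turns [V] into a bound on the squared distance. *)
    assert (E : (a1 - x) * (a1 - x) + (a2 - x * x) * (a2 - x * x) <= 0).
    { assert ((x * x + 1) * (2 * x * a1 - x * x - a2) <= 0) by nra. lra. }
    pose proof (Rle_0_sqr (a1 - x)) as S1. pose proof (Rle_0_sqr (a2 - x * x)) as S2.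
    unfold Rsqr in S1, S2.
    apply (pared_cylinder_edge_inv C a); [assumption|assumption|..];
      apply Rminus_diag_uniq, Rsqr_0_uniq; unfold Rsqr; fold a1 a2; lra.
  - intros [m Cm]. exists (point x (x * x) (INR m)).
    split; [now apply pared_cylinder_edge|]. intros q Aq.
    pose proof (pared_cylinder_tangent C q x Aq) as T. rewrite <- Hx.
    unfold point. hcoord.
    (* The goal's left side is this factor times [2 x q1 - x^2 - q2], which [T] makes
       nonpositive. *)
    assert (P : 0 <= (2 - alpha) * (x * x + 1)) by nra.
    nra.
Qed.

End Construction.

(** * Padding to [k] sets and change of parameter *)

Lemma proj_whole {H : HilbertSpace} (x : H) : proj (fun _ => True) x = x.
Proof. apply proj_unique; [exact I|]. intros a _. hexpand. lra. Qed.

Lemma relax_comp_pad {H : HilbertSpace} alpha (A : nat -> H -> Prop) j n x :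
  (forall i, (j <= i)%nat -> A i = fun _ => True) ->
  relax_comp alpha A (n + j) x = relax_comp alpha A j x.
Proof.
  intros HA. induction n as [|n IH]; simpl; [reflexivity|].
  rewrite IH, HA by lia. unfold rproj. rewrite proj_whole. hvec. ring.
Qed.

(* Inverts [2 t^3 + 3 t = 10 (1 - alpha) / (2 - alpha)] for [alpha]. *)
Definition relaxation_at (t : R) : R :=
  (10 - 2 * (2 * (t * t * t) + 3 * t)) / (10 - (2 * (t * t * t) + 3 * t)).

Lemma separation_of_closed_preimage (C : R -> Prop) x : Rtopology.closed_set C ->
  0 <= x <= 1 -> ~ C (relaxation_at x) ->
  exists r, 0 < r /\ forall t, C (relaxation_at t) -> r <= (t - x) * (t - x).
Proof.
  intros Ccl Hx NC. destruct (Ccl (relaxation_at x) NC) as [[d Hd] Hout].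
  assert (cont : continuity_pt relaxation_at x).
  { unfold relaxation_at. reg.
    (* The denominator of [relaxation_at] is then at least 5. *)
    assert (x * x * x <= 1); [|lra]. assert (0 <= x * x <= 1) by nra. nra. }
  destruct (cont d Hd) as [e [He Hlim]]. exists (e * e). split; [nra|].
  intros t Ct. destruct (Rle_or_lt (e * e) ((t - x) * (t - x))) as [|L]; [assumption|].
  exfalso. apply (Hout (relaxation_at t)); [|assumption].
  unfold disc; simpl.
  destruct (Req_dec x t) as [<-|Hne].
  - rewrite Rminus_diag, Rabs_R0. assumption.
  - apply Hlim. split; [split; [exact I|assumption]|]. simpl. unfold Rdist.
    apply Rabs_def1; nra.
Qed.

(** The difference of the two sides is [-10 (1 - alpha)] at 0 and [5 alpha] at 1, so the constant 10
    places the root in [[0, 1]]. *)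
Lemma relaxation_at_surj alpha : 0 < alpha <= 1 -> exists x, 0 <= x <= 1 /\
  (2 - alpha) * (2 * (x * x * x) + 3 * x) = 10 * (1 - alpha) /\
  relaxation_at x = alpha.
Proof.
  intros Ha.
  destruct (IVT_cor (fun t => (2 - alpha) * (2 * (t * t * t) + 3 * t) - 10 * (1 - alpha))
    0 1) as [x [Hx E]].
  - reg.
  - lra.
  - nra.
  - exists x. split; [assumption|].
    assert (E' : 2 * (x * x * x) + 3 * x = 10 * (1 - alpha) / (2 - alpha)).
    { apply (Rmult_eq_reg_l (2 - alpha)); [|lra]. field_simplify; lra. }
    split; [lra|]. unfold relaxation_at. rewrite E'. field. lra.
Qed.

(* The sets A_1,...,A_k are A 0,...,A (k-1); the composition
   P_{A_k}^a ... P_{A_1}^a is relax_comp a A k. *)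
Theorem theorem1 (H : HilbertSpace) (k : nat) (F : R -> Prop) :
  dim_ge3 H -> (3 <= k)%nat -> (forall a, F a -> 0 <= a <= 1) ->
  ((exists A : nat -> H -> Prop,
      (forall i, (i < k)%nat -> nonempty (A i) /\ convex (A i) /\ hclosed (A i)) /\
      (forall a, F a <-> (0 <= a <= 1 /\ exists x : H, relax_comp a A k x = x)))
   <-> (F 0 /\ F_sigma F)).
Proof.
  intros Hdim Hk HF01. split.
  - intros [A [HA HF]]. split.
    + apply HF. split; [lra|]. exists hzero. apply relax_comp_0.
    + eapply F_sigma_fixed_point_parameters; eassumption.
  - intros [F0 [C [Ccl HC]]].
    destruct (orthonormal_triple Hdim)
      as [e1 [e2 [e3 [[n11 [n22 n33]] [o12 [o13 o23]]]]]].
    (* The closed sets are pulled back to the first coordinate [t] of the edge. *)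
    set (D := fun m t => 0 <= t <= 1 /\ C m (relaxation_at t)).
    set (A := fun i : nat => match i with
      | 0%nat => flat e1 e2 10
      | 1%nat => flat e1 e2 0
      | 2%nat => pared_cylinder e1 e2 e3 D
      | _ => fun _ => True
      end).
    exists A. split.
    + intros i _. destruct i as [|[|[|i]]].
      * now apply (flat_closed_convex e1 e2 e3).
      * now apply (flat_closed_convex e1 e2 e3).
      * split; [|apply pared_cylinder_closed_convex].
        eexists. apply (pared_cylinder_dense e1 e2 e3) with (x := 0) (delta := 1);
          first [assumption|lra].
      * split; [now exists hzero|]. split; [now intros ?|]. intros x Hx. now elim Hx.
    (* At 0 the composition is the identity, in agreement with [F 0]; the cylinder handles positive
       parameters. *)
    + intros a. destruct (Req_dec a 0) as [->|Ha0].
      { split; [|easy]. intros _. split; [lra|]. exists hzero. apply relax_comp_0. }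
      replace k with (k - 3 + 3)%nat by lia.
      assert (E : (exists x : H, relax_comp a A (k - 3 + 3) x = x) <->
        exists x : H, relax_comp a A 3 x = x).
      { split; intros [x Hx]; exists x; [rewrite <- Hx at 2; symmetry|rewrite <- Hx at 2];
          apply relax_comp_pad; intros [|[|[|i]]] Hi; now try lia. }
      rewrite E. simpl.
      assert (key : 0 < a <= 1 -> ((exists x : H, rproj a (pared_cylinder e1 e2 e3 D)
        (rproj a (flat e1 e2 0) (rproj a (flat e1 e2 10) x)) = x) <-> F a)).
      { intros Ha. destruct (relaxation_at_surj a Ha) as [x [Hx [Ex Ax]]].
        rewrite (fixed_point_pared_cylinder e1 e2 e3) with (x := x);
          try assumption.
        - rewrite HC. unfold D. rewrite Ax.
          split; intros [m Cm]; exists m; tauto.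
        - intros m NDm.
          destruct (separation_of_closed_preimage (C m) x (Ccl m) Hx) as [r [Hr Hsep]].
          + intros Cm. now apply NDm.
          + exists r. split; [assumption|]. intros t [_ Ct]. now apply Hsep. }
      split.
      * intros Fa. pose proof (HF01 a Fa). split; [assumption|]. apply key; [lra|assumption].
      * intros [Ha Hfix]. apply key; [lra|assumption].
Qed.
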